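(* Let $m$ be a positive integer and let $n\geq 2m$ be an even integer. Let $E_{me}(n)$ denote the number of partitions of $n$ whose minimum part is $m$, in which the number of even parts and the number of odd parts are both even, and in which the number of even parts is strictly greater than the number of odd parts. Let $O_{me}(n)$ denote the number of partitions of $n$ whose minimum part is $m$, in which the number of even parts and the number of odd parts are both even, and in which the number of odd parts is strictly greater than the number of even parts. Then \[ O_{me}(n) < E_{me}(n) \quad \text{if } m \text{ is even}, \] and \[ O_{me}(n) > E_{me}(n) \quad \text{if } m \text{ is odd}. \]
   Context: A partition of $n$ is a non-increasing sequence of positive integers summing to $n$; its entries are its parts. Zero is counted as an even number (so a partition with no even parts has an even number of even parts). *)

(* Defs.v *)
From mathcomp Require Import all_boot.

Set Implicit Arguments.
Unset Strict Implicit.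
Unset Printing Implicit Defensive.

Definition is_partition (n : nat) (s : seq nat) : bool :=
  [&& sorted geq s, all (fun p => 0 < p) s & sumn s == n].

Definition min_part_is (m : nat) (s : seq nat) : bool :=
  (m \in s) && all (fun p => m <= p) s.

Definition num_even (s : seq nat) : nat := count (fun p => ~~ odd p) s.
Definition num_odd (s : seq nat) : nat := count odd s.

(* A partition of n has at most n parts, each at most n, so the partitions of n
   can be counted inside the finite type of sequences of length at most n over
   'I_n.+1; partition_encodable below shows that none is lost, and parts_of_inj that
   none is counted twice. *)
Definition parts_of (n : nat) (t : n.-bseq 'I_n.+1) : seq nat :=
  [seq val i | i <- t].

Definition num_partitions (n : nat) (P : pred (seq nat)) : nat :=
  #|[set t : n.-bseq 'I_n.+1 | is_partition n (parts_of t) && P (parts_of t)]|.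

Lemma parts_of_inj n : injective (@parts_of n).
Proof. by move=> s t /(inj_map val_inj) /val_inj. Qed.

Lemma partition_encodable n s :
  is_partition n s -> exists t : n.-bseq 'I_n.+1, parts_of t = s.
Proof.
case/and3P=> _ pos /eqP sum_s.
have size_s : size s <= n.
  rewrite -sum_s; elim: s pos {sum_s} => //= p s IHs /andP[p_gt0 /IHs].
  exact: (leq_add p_gt0).
have le_s : {in s, forall p, p < n.+1}.
  move=> p; rewrite ltnS -sum_s; elim: s {pos sum_s size_s} => //= q s IHs.
  rewrite inE => /predU1P[-> | /IHs le_p]; first exact: leq_addr.
  exact: leq_trans le_p (leq_addl _ _).
have size_t : size [seq (inord p : 'I_n.+1) | p <- s] <= n by rewrite size_map.
exists (Bseq size_t); rewrite /parts_of /= -map_comp.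
by apply: map_id_in => p /le_s lt_p /=; rewrite inordK.
Qed.

Definition E_me (m n : nat) : nat :=
  num_partitions n (fun s =>
    [&& min_part_is m s, ~~ odd (num_even s), ~~ odd (num_odd s)
      & num_odd s < num_even s]).

Definition O_me (m n : nat) : nat :=
  num_partitions n (fun s =>
    [&& min_part_is m s, ~~ odd (num_even s), ~~ odd (num_odd s)
      & num_even s < num_odd s]).

(* Main.v *)
Require Import Defs.
From mathcomp Require Import all_boot zify.

Set Implicit Arguments.
Unset Strict Implicit.
Unset Printing Implicit Defensive.

(** Call the parts of the parity of [m] the a-parts and the others the b-parts.
    Take a partition with minimum part [m], with a_1 >= ... >= a_2s = m and
    b_1 >= ... >= b_2r, s < r, and let d = b_2r - m, an odd number.  Adding d to
    every a_i, subtracting d from every b_i and then adding 2d to the r - s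
    largest of the b_i preserves the sum and exchanges the two parities; [m] is
    still the minimum part because b_2r - d = m.  The number d is read off the
    image as the least new b-part minus [m], so this map is injective.  It misses
    the partition (n - m, m), which has no b-part. *)

(** * Comparison of partition counts through an injection *)

Lemma num_partitions_lt (n : nat) (P Q : pred (seq nat))
    (f : seq nat -> seq nat) (s0 : seq nat) :
    (forall s, is_partition n s -> P s -> is_partition n (f s) && Q (f s)) ->
    (forall s t, is_partition n s -> P s -> is_partition n t -> P t ->
       f s = f t -> s = t) ->
    is_partition n s0 -> Q s0 ->
    (forall s, is_partition n s -> P s -> f s != s0) ->
  num_partitions n P < num_partitions n Q.
Proof.
move=> fPQ f_inj part0 Q0 f_neq0.
(* Lists of the sequences themselves, not of their encodings, so that [f] can act on the entries. *)
pose L (R : pred (seq nat)) := [seq parts_of t | t <-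
  enum [set t : n.-bseq 'I_n.+1 | is_partition n (parts_of t) && R (parts_of t)]].
have sizeL R : size (L R) = num_partitions n R by rewrite size_map -cardE.
have memL R s : (s \in L R) = is_partition n s && R s.
  apply/mapP/idP=> [[t] | /andP[part_s Rs]].
    by rewrite mem_enum inE => Rt ->.
  have [t def_s] := partition_encodable part_s.
  by exists t; rewrite // mem_enum inE def_s part_s Rs.
have uniqL R : uniq (L R) by rewrite map_inj_uniq ?enum_uniq //; apply: parts_of_inj.
(* The list [s0 :: map f (L P)] has no duplicates and lies inside [L Q]; its head gives
   strictness. *)
rewrite -!sizeL -(size_map f) -[_.+1]/(size (s0 :: _)).
apply: uniq_leq_size => /= [|s].
  apply/andP; split.
    apply/mapP=> -[s]; rewrite memL => /andP[part_s Ps] def0.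
    by have := f_neq0 s part_s Ps; rewrite def0 eqxx.
  rewrite map_inj_in_uniq // => s t.
  rewrite !memL => /andP[part_s Ps] /andP[part_t Pt]; exact: f_inj.
rewrite inE => /predU1P[-> | /mapP[t]]; first by rewrite memL part0.
by rewrite !memL => /andP[part_t Pt] ->; apply: fPQ.
Qed.

Lemma eq_num_partitions (n : nat) (P Q : pred (seq nat)) :
  P =1 Q -> num_partitions n P = num_partitions n Q.
Proof. by move=> eqPQ; apply: eq_card => t; rewrite !inE eqPQ. Qed.

(** * Non-increasing sequences and sums of shifted entries *)

Lemma geq_trans : transitive geq.
Proof. by move=> y x z /= le_yx le_zy; apply: leq_trans le_zy le_yx. Qed.

Lemma geq_total : total geq.
Proof. by move=> x y; apply: leq_total. Qed.

Lemma geq_anti : antisymmetric geq.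
Proof. by move=> x y; rewrite andbC => /anti_leq. Qed.

Lemma sorted_geq_last (x p : nat) (s : seq nat) :
  sorted geq s -> p \in s -> last x s <= p.
Proof.
case/lastP: s => // s y; rewrite last_rcons.
rewrite (sorted_pairwise geq_trans) pairwise_rcons mem_rcons inE.
by case/andP=> /allP le_s _ /predU1P[-> // | /le_s].
Qed.

Lemma sumn_map_addn (d : nat) (s : seq nat) :
  sumn [seq p + d | p <- s] = sumn s + d * size s.
Proof. by elim: s => [|p s /= ->] /=; lia. Qed.

Lemma sumn_map_subn (d : nat) (s : seq nat) :
  all (leq d) s -> sumn [seq p - d | p <- s] + d * size s = sumn s.
Proof. by elim: s => [|p s IHs] /=; [lia | case/andP=> le_dp /IHs; lia]. Qed.

Definition same_parity (m : nat) : pred nat := fun p => odd p == odd m.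

(** For a non-increasing [s] with entries at least [d], this amounts to subtracting [d] everywhere
    and then adding [2 * d] to the [h] largest entries. *)
Definition spread (h d : nat) (s : seq nat) : seq nat :=
  [seq p + d | p <- take h s] ++ [seq p - d | p <- drop h s].

Lemma size_spread (h d : nat) (s : seq nat) : size (spread h d s) = size s.
Proof. by rewrite size_cat !size_map -size_cat cat_take_drop. Qed.

Lemma all_take_drop (h : nat) (P : pred nat) (s : seq nat) :
  all P (take h s) && all P (drop h s) = all P s.
Proof. by rewrite -all_cat cat_take_drop. Qed.

Lemma sumn_spread (h d : nat) (s : seq nat) :
    all (leq d) s -> h <= size s ->
  sumn (spread h d s) + d * size s = sumn s + 2 * h * d.
Proof.
rewrite -(all_take_drop h) => /andP[_ /sumn_map_subn sum_drop] le_h.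
have := congr1 sumn (cat_take_drop h s); rewrite sumn_cat.
rewrite sumn_cat sumn_map_addn size_takel //.
move: sum_drop; rewrite size_drop; nia.
Qed.

(** Within each block the shift is monotone, and across the cut the larger entries rise while the
    smaller ones fall. *)
Lemma sorted_spread (h d : nat) (s : seq nat) :
  sorted geq s -> sorted geq (spread h d s).
Proof.
rewrite !(sorted_pairwise geq_trans) -{1}(cat_take_drop h s) !pairwise_cat.
case/and3P=> /allrelP rel_td pw_t pw_d; apply/and3P; split.
- apply/allrelP=> _ _ /mapP[x xt ->] /mapP[y yd ->].
  by have /= := rel_td x y xt yd; lia.
- by rewrite pairwise_map; apply: sub_pairwise pw_t => x y /=; lia.
by rewrite pairwise_map; apply: sub_pairwise pw_d => x y /=; lia.
Qed.

(** Equal sizes align the two cuts, and on entries at least [d] addition undoes the truncated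
    subtraction. *)
Lemma spread_inj (h d : nat) (s t : seq nat) :
    all (leq d) s -> all (leq d) t -> size s = size t ->
  spread h d s = spread h d t -> s = t.
Proof.
rewrite -(all_take_drop h _ s) -(all_take_drop h _ t).
move=> /andP[_ /allP ge_s] /andP[_ /allP ge_t] eq_size /eqP.
rewrite eqseq_cat ?size_map ?size_take ?eq_size //.
case/andP=> /eqP/(inj_map (@addIn d)) eq_take /eqP eq_drop.
rewrite -(cat_take_drop h s) -(cat_take_drop h t) eq_take; congr (_ ++ _).
have subK u : {in u, forall p, d <= p} ->
    [seq p + d | p <- [seq p - d | p <- u]] = u.
  by move=> ge_u; rewrite -map_comp map_id_in // => p /ge_u /= /subnK.
by rewrite -(subK _ ge_s) eq_drop subK.
Qed.

(** * The exchange of the two parity classes *)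

Definition gap (m : nat) (s : seq nat) : nat :=
  last m (filter (predC (same_parity m)) s) - m.

(** This is r - s when there are 2r b-parts and 2s a-parts. *)
Definition surplus (m : nat) (s : seq nat) : nat :=
  (count (predC (same_parity m)) s - count (same_parity m) s)./2.

(** Named for the parity after the exchange: the old b-parts, moved by an odd amount, become the new
    a-parts. *)
Definition new_same (m : nat) (s : seq nat) : seq nat :=
  spread (surplus m s) (gap m s) (filter (predC (same_parity m)) s).

Definition new_other (m : nat) (s : seq nat) : seq nat :=
  [seq p + gap m s | p <- filter (same_parity m) s].

Definition exchange (m : nat) (s : seq nat) : seq nat :=
  sort geq (new_same m s ++ new_other m s).

(** Taking the even and the odd parts for [A] and [B], in either order, gives the conditions of
    [E_me] and [O_me]; parity relative to [m] treats both cases at once. *)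
Definition dominates (m : nat) (A B : pred nat) (s : seq nat) : bool :=
  [&& min_part_is m s, ~~ odd (count A s), ~~ odd (count B s)
    & count B s < count A s].

Section Exchange.

Variables (m n : nat) (s : seq nat).
Hypothesis part_s : is_partition n s.
Hypothesis dom_s : dominates m (predC (same_parity m)) (same_parity m) s.

Let a := filter (same_parity m) s.
Let b := filter (predC (same_parity m)) s.
Let d := gap m s.
Let h := surplus m s.

Lemma sorted_filter_part (P : pred nat) : sorted geq (filter P s).
Proof. by case/and3P: part_s => s_sorted _ _; apply: (sorted_filter geq_trans). Qed.

Lemma min_part_le p : p \in s -> m <= p.
Proof. by case/and4P: dom_s => /andP[_ /allP le_m _ _ _ /le_m]. Qed.

Lemma mem_same : m \in a.
Proof.
by case/and4P: dom_s => /andP[m_s _] _ _ _; rewrite mem_filter /same_parity eqxx.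
Qed.

Lemma last_same : last m a = m.
Proof.
apply/anti_leq/andP; split.
  exact: (sorted_geq_last _ (sorted_filter_part _) mem_same).
(* Either the default [m] or a genuine entry of [a] is returned; both belong to [s]. *)
apply: min_part_le; have := mem_last m a; rewrite inE => /predU1P[->|].
  by have := mem_same; rewrite mem_filter => /andP[].
by rewrite mem_filter => /andP[].
Qed.

Lemma surplusE : size b = size a + 2 * h.
Proof.
rewrite !size_filter /h /surplus; case/and4P: dom_s => _.
by move: (count _ s) (count _ s) => x y; lia.
Qed.

Lemma size_same_gt0 : 0 < size a.
Proof. by have := mem_same; case: a. Qed.

(** Strictness comes from [a] being nonempty; it puts the least b-part among the lowered entries. *)
Lemma surplus_lt : h < size b.
Proof. by have := surplusE; have := size_same_gt0; lia. Qed.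

Lemma last_other : last m b \in b.
Proof. by have := surplus_lt; case: b => // x u _; apply: mem_last. Qed.

Lemma last_otherE : last m b = m + d.
Proof.
rewrite /d /gap subnKC //; apply: min_part_le.
by have := last_other; rewrite mem_filter => /andP[].
Qed.

Lemma odd_gap : odd d.
Proof.
have := last_other; rewrite last_otherE mem_filter => /andP[+ _].
by rewrite /= /same_parity oddD; case: (odd m) (odd d) => [] [].
Qed.

Lemma other_ge p : p \in b -> m + d <= p.
Proof. by rewrite -last_otherE; apply: sorted_geq_last (sorted_filter_part _). Qed.

Lemma all_gap_other : all (leq d) b.
Proof. by apply/allP=> p /other_ge; lia. Qed.

(** Shifting by the odd [d] flips parity, and a b-part, being at least [m + d], cannot drop below
    [m]. *)
Lemma new_sameP p : p \in new_same m s -> same_parity m p /\ m <= p.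
Proof.
rewrite /new_same -/b -/d -/h mem_cat.
have dP := odd_gap.
have bP q : q \in b -> odd q = ~~ odd m /\ m + d <= q.
  move=> qb; split; last exact: other_ge.
  by move: qb; rewrite mem_filter /= /same_parity; case: odd (odd m) => [] [].
case/orP=> /mapP[q]; [move/mem_take | move/mem_drop];
  move=> /bP[q_odd le_q] ->; rewrite /same_parity.
  by rewrite oddD q_odd dP addbT negbK eqxx; lia.
rewrite oddB ?q_odd ?dP ?addbT ?negbK ?eqxx; lia.
Qed.

Lemma new_otherP p : p \in new_other m s -> ~~ same_parity m p /\ m <= p.
Proof.
rewrite /new_other -/a -/d => /mapP[q] + ->; rewrite mem_filter.
case/andP=> /eqP q_odd /min_part_le; rewrite /same_parity oddD q_odd odd_gap.
by case: (odd m); lia.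
Qed.

Lemma mem_new_same : m \in new_same m s.
Proof.
rewrite /new_same -/b -/d -/h mem_cat; apply/orP; right.
apply/mapP; exists (last m b); last by rewrite last_otherE addnK.
rewrite -{1}(cat_take_drop h b) last_cat.
have: 0 < size (drop h b) by rewrite size_drop subn_gt0 surplus_lt.
by case: (drop h b) => // x u _; apply: mem_last.
Qed.

Lemma sort_filter_exchange (P : pred nat) :
  filter P (exchange m s) = sort geq (filter P (new_same m s ++ new_other m s)).
Proof. exact: (filter_sort geq_total geq_trans). Qed.

(** Filtering commutes with sorting, and [new_same] is already sorted, so the image gives this list
    back unchanged. *)
Lemma filter_same_exchange : filter (same_parity m) (exchange m s) = new_same m s.
Proof.
rewrite sort_filter_exchange filter_cat (all_filterP _); last first.
  by apply/allP=> p /new_sameP[].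
have /eqP -> : filter (same_parity m) (new_other m s) == [::].
  by rewrite -[_ == _]negbK -has_filter; apply/hasPn=> p /new_otherP[].
rewrite cats0 (sorted_sort geq_trans) //.
exact/sorted_spread/sorted_filter_part.
Qed.

Lemma filter_other_exchange :
  filter (predC (same_parity m)) (exchange m s) = new_other m s.
Proof.
rewrite sort_filter_exchange filter_cat [X in _ ++ X](all_filterP _); last first.
  by apply/allP=> p /new_otherP[].
have /eqP -> : filter (predC (same_parity m)) (new_same m s) == [::].
  rewrite -[_ == _]negbK -has_filter; apply/hasPn=> p /new_sameP[] /=.
  by rewrite negbK.
rewrite (sorted_sort geq_trans) // sorted_map.
by apply: sub_sorted (sorted_filter_part _) => x y /=; lia.
Qed.

Lemma exchangeP :
    0 < m ->
  is_partition n (exchange m s)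
    && dominates m (same_parity m) (predC (same_parity m)) (exchange m s).
Proof.
move=> m_gt0; have ge_m : all (leq m) (exchange m s).
  apply/allP=> p; rewrite mem_sort mem_cat.
  by case/orP=> [/new_sameP[] | /new_otherP[]].
have m_in : m \in exchange m s by rewrite mem_sort mem_cat mem_new_same.
have size_same : count (same_parity m) (exchange m s) = size b.
  by rewrite -size_filter filter_same_exchange size_spread.
have size_other : count (predC (same_parity m)) (exchange m s) = size a.
  by rewrite -size_filter filter_other_exchange size_map.
apply/andP; split; last first.
  rewrite /dominates /min_part_is m_in ge_m size_same size_other !size_filter.
  by case/and4P: dom_s => _ -> -> ->.
apply/and3P; split; first exact: (sort_sorted geq_total).
  by apply: sub_all ge_m => p; apply: leq_trans.
have /and3P[_ _ /eqP <-] := part_s.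
have /perm_sumn -> : perm_eq (exchange m s) (new_same m s ++ new_other m s).
  by rewrite perm_sort.
have /perm_sumn <- : perm_eq (a ++ b) s by rewrite perm_filterC.
(* The b-parts lose [d * size a] in total, exactly what the a-parts gain. *)
have := sumn_spread all_gap_other (ltnW surplus_lt).
rewrite surplusE !(sumn_cat _ (new_other _ _), sumn_cat a) sumn_map_addn.
by rewrite /new_same -/a -/b -/d -/h => sum_b; apply/eqP; nia.
Qed.

End Exchange.

(** * Injectivity and the strict inequality *)

Lemma exchange_inj (m n : nat) (s t : seq nat) :
    is_partition n s -> dominates m (predC (same_parity m)) (same_parity m) s ->
    is_partition n t -> dominates m (predC (same_parity m)) (same_parity m) t ->
  exchange m s = exchange m t -> s = t.
Proof.
move=> part_s dom_s part_t dom_t eq_st.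
have := congr1 (filter (same_parity m)) eq_st.
rewrite !(filter_same_exchange (n := n)) // => eq_same.
have := congr1 (filter (predC (same_parity m))) eq_st.
rewrite !(filter_other_exchange (n := n)) // => eq_other.
(* The least old a-part is [m], so the least new b-part reveals the gap; with it [a], the surplus
   and [b] are recovered in turn. *)
have last_new u : is_partition n u ->
    dominates m (predC (same_parity m)) (same_parity m) u ->
    last m (new_other m u) = m + gap m u.
  move=> part_u dom_u; move: (size_same_gt0 dom_u) (last_same part_u dom_u).
  rewrite /new_other; case: filter => //= x v _ last_m.
  by rewrite (last_map (addn^~ (gap m u)) v x) last_m.
have eq_gap : gap m s = gap m t.
  by apply/(@addnI m); rewrite -!last_new // eq_other.
have eq_a : filter (same_parity m) s = filter (same_parity m) t.
  by move: eq_other; rewrite /new_other eq_gap => /(inj_map (@addIn _)).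
have eq_size : size (filter (predC (same_parity m)) s)
    = size (filter (predC (same_parity m)) t).
  by have := congr1 size eq_same; rewrite !size_spread.
have eq_surplus : surplus m s = surplus m t.
  by rewrite /surplus -!size_filter eq_size eq_a.
have eq_b : filter (predC (same_parity m)) s = filter (predC (same_parity m)) t.
  move: eq_same; rewrite /new_same eq_gap eq_surplus; apply: spread_inj => //.
    by rewrite -eq_gap; apply: all_gap_other part_s dom_s.
  exact: all_gap_other part_t dom_t.
have /and3P[sorted_s _ _] := part_s; have /and3P[sorted_t _ _] := part_t.
(* The two parity classes fix the multiset of parts, and sortedness fixes their order. *)
apply: (sorted_eq geq_trans geq_anti sorted_s sorted_t).
rewrite -(perm_filterC (same_parity m) s) perm_sym.
by rewrite -(perm_filterC (same_parity m) t) eq_a eq_b.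
Qed.

Lemma num_dominates_lt (m n : nat) :
    0 < m -> ~~ odd n -> 2 * m <= n ->
  num_partitions n (dominates m (predC (same_parity m)) (same_parity m))
    < num_partitions n (dominates m (same_parity m) (predC (same_parity m))).
Proof.
move=> m_gt0 n_even le_2m_n.
have same_nm : same_parity m (n - m) by rewrite /same_parity; lia.
have same_m : same_parity m m by rewrite /same_parity.
apply: (num_partitions_lt (f := exchange m) (s0 := [:: n - m; m])).
- by move=> s part_s dom_s; apply: exchangeP.
- by move=> s t; apply: exchange_inj.
- by rewrite /is_partition /= ; lia.
- by rewrite /dominates /min_part_is /= same_nm same_m !inE eqxx orbT /=; lia.
move=> s part_s dom_s; apply/eqP=> eq_s0.
(* An image has as many b-parts as [s] has a-parts, hence at least one. *)
have := filter_other_exchange part_s dom_s; rewrite eq_s0 /= same_nm same_m /=.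
move/(congr1 size); rewrite size_map /=.
by have := size_same_gt0 dom_s; lia.
Qed.

Theorem theorem3p1 (m n : nat) (m_gt0 : 0 < m) (n_even : ~~ odd n)
    (le_2m_n : 2 * m <= n) :
  (~~ odd m -> O_me m n < E_me m n) /\ (odd m -> O_me m n > E_me m n).
Proof.
have count_odd_m : odd m -> forall s, count (same_parity m) s = num_odd s
    /\ count (predC (same_parity m)) s = num_even s.
  by move=> m_odd s; split; apply: eq_count => p;
    rewrite /= /same_parity m_odd eqb_id.
have count_even_m : ~~ odd m -> forall s, count (same_parity m) s = num_even s
    /\ count (predC (same_parity m)) s = num_odd s.
  by move=> /negbTE m_even s; split; apply: eq_count => p;
    rewrite /= /same_parity m_even eqbF_neg ?negbK.
have lt_dom := num_dominates_lt m_gt0 n_even le_2m_n; rewrite /O_me /E_me.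
(* The predicates now differ at most in the order of the two evenness conditions. *)
by split=> [/count_even_m | /count_odd_m] countE; move: lt_dom;
  congr (_ < _); apply: eq_num_partitions => s;
  rewrite /dominates; case: (countE s) => -> ->; do !bool_congr.
Qed.
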